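(* Let $(A,A',\rho,\mu,\eta,\xi)$ be a matched pair of associative algebras $(A,\cdot_A)$ and $(A',\cdot_{A'})$. Then $\left(s\left(\bigoplus_{n=0}^{+\infty}\mathrm{Hom}(\otimes^{n+1}A',A)\right),[\![\cdot,\cdot]\!],\mathrm{d}\right)$ is a differential graded Lie algebra, where the graded Lie bracket is $$\begin{aligned} &[\![f_1,f_2]\!](u_1,\dots,u_{m_1+m_2})\\ =&\,f_2(u_1,\dots,u_{m_2})\cdot_Af_1(u_{m_2+1},\dots,u_{m_1+m_2})-(-1)^{m_1m_2}f_1(u_1,\dots,u_{m_1})\cdot_Af_2(u_{m_1+1},\dots,u_{m_1+m_2})\\ &+\sum_{i=1}^{m_1}(-1)^{im_2}f_1(u_1,\dots,u_{i-1},\mu(u_i,f_2(u_{i+1},\dots,u_{i+m_2})),u_{i+m_2+1},\dots,u_{m_1+m_2})\\ &-\sum_{i=1}^{m_1}(-1)^{(i-1)m_2}f_1(u_1,\dots,u_{i-1},\rho(f_2(u_i,\dots,u_{i+m_2-1}),u_{i+m_2}),u_{i+m_2+1},\dots,u_{m_1+m_2})\\ &+(-1)^{m_1m_2}\sum_{i=1}^{m_2}(-1)^{(i-1)m_1}f_2(u_1,\dots,u_{i-1},\rho(f_1(u_i,\dots,u_{i+m_1-1}),u_{i+m_1}),u_{i+m_1+1},\dots,u_{m_1+m_2})\\ &-(-1)^{m_1(m_2+1)}\sum_{i=1}^{m_2}(-1)^{(i-1)m_1}f_2(u_1,\dots,u_{i-1},\mu(u_i,f_1(u_{i+1},\dots,u_{i+m_1})),u_{i+m_1+1},\dots,u_{m_1+m_2})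 \end{aligned}$$ and the differential is $$\begin{aligned} \mathrm{d}f(u_1,\dots,u_{m+1})=&\,\xi(f(u_1,\dots,u_m),u_{m+1})+(-1)^{m-1}\eta(u_1,f(u_2,\dots,u_{m+1}))\\ &+(-1)^{m-1}\sum_{i=1}^m(-1)^if(u_1,\dots,u_{i-1},u_i\cdot_{A'}u_{i+1},u_{i+2},\dots,u_{m+1}), \end{aligned}$$ for all $f\in\mathrm{Hom}(\otimes^mA',A)$, $f_1\in\mathrm{Hom}(\otimes^{m_1}A',A)$, $f_2\in\mathrm{Hom}(\otimes^{m_2}A',A)$ and all $u_j\in A'$. Moreover, the Maurer-Cartan elements of this differential graded Lie algebra are exactly the deformation maps of the matched pair $(A,A')$ of associative algebras.
   Context: All vector spaces are over a field $\mathbb{K}$ of characteristic $0$; associative algebras are not assumed unital. A representation of an associative algebra $(A,\cdot_A)$ on a vector space $V$ is a triple $(V;\rho,\mu)$ with linear maps $\rho,\mu:A\to\mathfrak{gl}(V)$ such that $\rho(x\cdot_Ay)=\rho(x)\circ\rho(y)$, $\mu(x\cdot_Ay)=\mu(y)\circ\mu(x)$, $\rho(x)\circ\mu(y)=\mu(y)\circ\rho(x)$ for all $x,y\in A$. A matched pair of associative algebras $(A,A',\rho,\mu,\eta,\xi)$ consists of associative algebras $(A,\cdot_A)$, $(A',\cdot_{A'})$ and linear maps $\rho,\mu:A\to\mathfrak{gl}(A')$, $\eta,\xi:A'\to\mathfrak{gl}(A)$ such that $(A';\rho,\mu)$ is a representation of $A$, $(A;\eta,\xi)$ is a representation of $A'$,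 and for all $x,y\in A$, $u,v\in A'$: $\rho(x)(u\cdot_{A'}v)=\rho(\xi(u)x)v+(\rho(x)u)\cdot_{A'}v$; $\mu(x)(u\cdot_{A'}v)=\mu(\eta(v)x)u+u\cdot_{A'}(\mu(x)v)$; $\eta(u)(x\cdot_Ay)=\eta(\mu(x)u)y+(\eta(u)x)\cdot_Ay$; $\xi(u)(x\cdot_Ay)=\xi(\rho(y)u)x+x\cdot_A(\xi(u)y)$; $\rho(\eta(u)x)v+(\mu(x)u)\cdot_{A'}v=\mu(\xi(v)x)u+u\cdot_{A'}(\rho(x)v)$; $\eta(\rho(x)u)y+(\xi(u)x)\cdot_Ay=\xi(\mu(y)u)x+x\cdot_A(\eta(u)y)$. Bilinear notation used in the claim: $\rho(x,u)=\rho(x)u$, $\mu(u,x)=\mu(x)u$, $\eta(u,x)=\eta(u)x$, $\xi(x,u)=\xi(u)x$. A deformation map of the matched pair is a linear map $B:A'\to A$ with $B(u)\cdot_AB(v)+\xi(v)B(u)+\eta(u)B(v)=B(u\cdot_{A'}v+\rho(B(u))v+\mu(B(v))u)$ for all $u,v\in A'$. Grading: $\mathrm{Hom}(\otimes^{n+1}A',A)$ has degree $n$ in $\bigoplus_{n\ge0}\mathrm{Hom}(\otimes^{n+1}A',A)$, and the suspension $s$ shifts by $(s\mathfrak{g})^i=\mathfrak{g}^{i-1}$, so in $s(\cdots)$ an element of $\mathrm{Hom}(\otimes^mA',A)$ has degree $m$. The bracket has degree $0$ and $\mathrm{d}$ degree $1$. A Maurer-Cartan element of a differential graded Lie algebra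 is a degree $1$ element $x$ with $\mathrm{d}x+\frac12[\![x,x]\!]=0$. *)

(* Defs.v *)
From HB Require Import structures.
From mathcomp Require Import all_boot all_order all_algebra.
From mathcomp Require Import boolp classical_sets functions.
From mathcomp Require Import zify.

Set Implicit Arguments.
Unset Strict Implicit.
Unset Printing Implicit Defensive.

Import GRing.Theory.
Local Open Scope ring_scope.

(** A linear map [A -> gl(V)] is represented by its uncurried form
    [{bilinear A -> V -> V}].  An associative algebra, not assumed unital, is a
    K-vector space with an associative bilinear product. *)

Section MatchedPair.
Variable K : fieldType.

Definition representation (A : lmodType K) (mulA : {bilinear A -> A -> A})
    (V : lmodType K) (rho mu : {bilinear A -> V -> V}) : Prop :=
  [/\ forall x y v, rho (mulA x y) v = rho x (rho y v),
      forall x y v, mu (mulA x y) v = mu y (mu x v)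
    & forall x y v, rho x (mu y v) = mu y (rho x v)].

Record matched_pair (A A' : lmodType K)
    (mulA : {bilinear A -> A -> A}) (mulA' : {bilinear A' -> A' -> A'})
    (rho mu : {bilinear A -> A' -> A'})
    (eta xi : {bilinear A' -> A -> A}) : Prop := MatchedPair {
  mp_assocl : associative mulA;
  mp_assocr : associative mulA';
  mp_repl : representation mulA rho mu;
  mp_repr : representation mulA' eta xi;
  mp_rho : forall x u v,
    rho x (mulA' u v) = rho (xi u x) v + mulA' (rho x u) v;
  mp_mu : forall x u v,
    mu x (mulA' u v) = mu (eta v x) u + mulA' u (mu x v);
  mp_eta : forall u x y,
    eta u (mulA x y) = eta (mu x u) y + mulA (eta u x) y;
  mp_xi : forall u x y,
    xi u (mulA x y) = xi (rho y u) x + mulA x (xi u y);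
  mp_mixl : forall x u v,
    rho (eta u x) v + mulA' (mu x u) v = mu (xi v x) u + mulA' u (rho x v);
  mp_mixr : forall u x y,
    eta (rho x u) y + mulA (xi u x) y = xi (mu y u) x + mulA x (eta u y)
}.

Definition deformation_map (A A' : lmodType K)
    (mulA : {bilinear A -> A -> A}) (mulA' : {bilinear A' -> A' -> A'})
    (rho mu : {bilinear A -> A' -> A'}) (eta xi : {bilinear A' -> A -> A})
    (B : {linear A' -> A}) : Prop :=
  forall u v, mulA (B u) (B v) + xi v (B u) + eta u (B v) =
              B (mulA' u v + rho (B u) v + mu (B v) u).

End MatchedPair.

(** A graded vector space is the Z-indexed family of its homogeneous
    components.  To avoid transport along equalities of degrees, a bilinear
    operation of degree 0 is a family of maps [L i -> L j -> L k] indexed by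
    the proofs of [i + j = k], and likewise for operators of degree 1. *)

Section DGLA.
Variable K : fieldType.

Definition graded_bracket (L : int -> lmodType K) :=
  forall i j k : int, i + j = k -> L i -> L j -> L k.

Definition graded_differential (L : int -> lmodType K) :=
  forall i j : int, i + 1 = j -> L i -> L j.

Record is_dgla (L : int -> lmodType K) (br : graded_bracket L)
    (d : graded_differential L) : Prop := IsDGLA {
  dgla_linearl : forall i j k (e : i + j = k) (y : L j),
    linear (fun x : L i => br i j k e x y);
  dgla_linearr : forall i j k (e : i + j = k) (x : L i),
    linear (br i j k e x);
  dgla_antisym : forall i j k (e : i + j = k) (e' : j + i = k)
      (x : L i) (y : L j),
    br i j k e x y = - ((-1) ^ (i * j) *: br j i k e' y x);
  dgla_jacobi : forall i j k ij jk ik n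
      (eij : i + j = ij) (ejk : j + k = jk) (eik : i + k = ik)
      (e1 : i + jk = n) (e2 : ij + k = n) (e3 : j + ik = n)
      (x : L i) (y : L j) (z : L k),
    br i jk n e1 x (br j k jk ejk y z) =
      br ij k n e2 (br i j ij eij x y) z +
      (-1) ^ (i * j) *: br j ik n e3 y (br i k ik eik x z);
  dgla_dlinear : forall i j (e : i + 1 = j), linear (d i j e);
  dgla_dd : forall i j k (e1 : i + 1 = j) (e2 : j + 1 = k) (x : L i),
    d j k e2 (d i j e1 x) = 0;
  dgla_leibniz : forall i j k i' j' k'
      (e : i + j = k) (ei : i + 1 = i') (ej : j + 1 = j') (ek : k + 1 = k')
      (e1 : i' + j = k') (e2 : i + j' = k') (x : L i) (y : L j),
    d k k' ek (br i j k e x y) =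
      br i' j k' e1 (d i i' ei x) y +
      (-1) ^ i *: br i j' k' e2 x (d j j' ej y)
}.

Definition maurer_cartan (L : int -> lmodType K) (br : graded_bracket L)
    (d : graded_differential L) (x : L 1) : Prop :=
  d 1 2 erefl x + 2%:R^-1 *: br 1 1 2 erefl x x = 0.

Definition suspension (L : int -> lmodType K) : int -> lmodType K :=
  fun i => L (i - 1).

End DGLA.

(** [multihom U V m] is Hom(U^{(x) m}, V), as the vector space of m-linear maps
    from U to V. *)

Section Multihom.
Variables (K : fieldType) (U V : lmodType K).

Definition upd n (u : n.-tuple U) (j : 'I_n) (x : U) : n.-tuple U :=
  [tuple if k == j then x else tnth u k | k < n].

Definition linear_at n (W : lmodType K) (j : 'I_n) (F : n.-tuple U -> W) :=
  forall u, linear (fun x => F (upd u j x)).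

Definition multilinear n : {pred n.-tuple U -> V} :=
  fun f => `[< forall j, linear_at j f >].

Lemma multilinear_submod n : submod_closed (@multilinear n).
Proof.
split=> [|a f g /asboolP fl /asboolP gl]; apply/asboolP => j u b x y.
  by rewrite /= scaler0 addr0.
have E v : (a *: f + g) v = a *: f v + g v by [].
rewrite !E fl gl.
by rewrite !scalerDr !scalerA -!addrA (mulrC b) [in LHS](addrCA (a *: f _)).
Qed.

HB.instance Definition _ n :=
  GRing.isSubmodClosed.Build K (n.-tuple U -> V) (@multilinear n)
    (multilinear_submod n).

Record multihom n := Multihom {
  multihom_fun :> n.-tuple U -> V;
  _ : multihom_fun \in @multilinear n
}.

HB.instance Definition _ n := [isSub for @multihom_fun n].
HB.instance Definition _ n := [Choice of multihom n by <:].
HB.instance Definition _ n := [SubChoice_isSubLmodule of multihom n by <:].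

Lemma multihom_linear_at n (f : multihom n) j : linear_at j f.
Proof. by case: f => f fl; move: j; exact/asboolP. Qed.

(** Meaningful when [size s = n], where it is [f] at the tuple of entries of
    [s]. *)
Definition app n (f : multihom n) (s : seq U) : V :=
  f [tuple nth 0 s k | k < n].

(** 1-based: [entry s i] is u_i and [slice s i j] is (u_i, ..., u_j), for
    s = (u_1, u_2, ...). *)
Definition entry (s : seq U) (i : nat) : U := nth 0 s i.-1.
Definition slice (s : seq U) (i j : nat) : seq U := drop i.-1 (take j s).

End Multihom.

Section MultilinearTheory.
Variables (K : fieldType) (U : lmodType K).

Definition const_at n (T : Type) (j : 'I_n) (F : n.-tuple U -> T) :=
  forall u x, F (upd u j x) = F u.

Lemma nth_upd n (u : n.-tuple U) j x k :
  nth 0 (upd u j x) k = if k == j then x else nth 0 u k.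
Proof.
case: (ltnP k n) => [kn|nk]; last first.
  rewrite !nth_default ?size_tuple //; case: eqP => // ek.
  by have := ltn_ord j; rewrite -ek ltnNge nk.
by rewrite -[k]/(val (Ordinal kn)) -!tnth_nth tnth_mktuple.
Qed.

Lemma nth_linear_at n (j : 'I_n) k : k = j :> nat ->
  linear_at (W := U) j (fun u => nth 0 u k).
Proof. by move=> -> u a x y; rewrite !nth_upd eqxx. Qed.

Lemma nth_const_at n (j : 'I_n) k : k <> j :> nat ->
  const_at j (fun u => nth 0 u k).
Proof. by move=> /eqP kj u x; rewrite nth_upd (negPf kj). Qed.

Lemma linear_at_ext n (W : lmodType K) (j : 'I_n) (F G : n.-tuple U -> W) :
  F =1 G -> linear_at j F -> linear_at j G.
Proof. by move=> FG Fl u a x y; rewrite -!FG Fl. Qed.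

Lemma const_at_ext n T (j : 'I_n) (F G : n.-tuple U -> T) :
  F =1 G -> const_at j F -> const_at j G.
Proof. by move=> FG Fl u x; rewrite -!FG Fl. Qed.

Lemma linear_atD n (W : lmodType K) (j : 'I_n) (F G : n.-tuple U -> W) :
  linear_at j F -> linear_at j G -> linear_at j (fun u => F u + G u).
Proof.
by move=> Fl Gl u a x y; rewrite Fl Gl scalerDr -!addrA [in LHS](addrCA (F _)).
Qed.

Lemma linear_atZ n (W : lmodType K) (j : 'I_n) c (F : n.-tuple U -> W) :
  linear_at j F -> linear_at j (fun u => c *: F u).
Proof. by move=> Fl u a x y; rewrite Fl scalerDr !scalerA mulrC. Qed.

Lemma linear_atN n (W : lmodType K) (j : 'I_n) (F : n.-tuple U -> W) :
  linear_at j F -> linear_at j (fun u => - F u).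
Proof. by move=> Fl u a x y; rewrite Fl opprD scalerN. Qed.

Lemma linear_at_sum n (W : lmodType K) (j : 'I_n) p q
    (F : nat -> n.-tuple U -> W) :
  (forall i, (p <= i < q)%N -> linear_at j (F i)) ->
  linear_at j (fun u => \sum_(p <= i < q) F i u).
Proof.
move=> Fl u a x y; rewrite scaler_sumr -big_split /=.
by apply: eq_big_nat => i iI; rewrite Fl.
Qed.

Lemma linear_at_bil n (W1 W2 W : lmodType K) (b : {bilinear W1 -> W2 -> W})
    (j : 'I_n) (F : n.-tuple U -> W1) (G : n.-tuple U -> W2) :
  (linear_at j F /\ const_at j G) \/ (const_at j F /\ linear_at j G) ->
  linear_at j (fun u => b (F u) (G u)).
Proof.
move=> [[Fl Gl]|[Fl Gl]] u a x y.
  by rewrite !Gl Fl linearPl.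
by rewrite !Fl Gl linearPr.
Qed.

Lemma const_at_bil n (W1 W2 W : lmodType K) (b : {bilinear W1 -> W2 -> W})
    (j : 'I_n) (F : n.-tuple U -> W1) (G : n.-tuple U -> W2) :
  const_at j F -> const_at j G -> const_at j (fun u => b (F u) (G u)).
Proof. by move=> Fl Gl u x; rewrite Fl Gl. Qed.

Variable V : lmodType K.

Lemma app_const_at n m (f : multihom U V m) (G : n.-tuple U -> seq U) j :
  (forall k, (k < m)%N -> const_at j (fun u => nth 0 (G u) k)) ->
  const_at j (fun u => app f (G u)).
Proof.
move=> Gc u x; congr (f _); apply: eq_from_tnth => k.
by rewrite !tnth_mktuple Gc.
Qed.

Lemma app_linear_at n m (f : multihom U V m) (G : n.-tuple U -> seq U) j p :
  (p < m)%N -> linear_at j (fun u => nth 0 (G u) p) ->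
  (forall k, (k < m)%N -> k <> p -> const_at j (fun u => nth 0 (G u) k)) ->
  linear_at j (fun u => app f (G u)).
Proof.
move=> pm Gl Gc u a x y.
have E z : app f (G (upd u j z)) =
    f (upd [tuple nth 0 (G u) k | k < m] (Ordinal pm) (nth 0 (G (upd u j z)) p)).
  congr (f _); apply: eq_from_tnth => k.
  rewrite !tnth_mktuple; case: eqP => [-> //|/eqP kp].
  by rewrite Gc // => ke; move: kp; rewrite -val_eqE /= ke eqxx.
by rewrite !E Gl multihom_linear_at.
Qed.

Lemma nth_slice (s : seq U) a b k :
  (a.-1 + k < b)%N -> nth 0 (slice s a b) k = nth 0 s (a.-1 + k).
Proof. by move=> h; rewrite nth_drop nth_take. Qed.

Lemma slice_linear_at n m (f : multihom U V m) a b (j : 'I_n) :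
  (a.-1 + m <= b)%N -> (a.-1 <= j < a.-1 + m)%N ->
  linear_at j (fun u => app f (slice u a b)).
Proof.
move=> mb /andP[aj jm]; apply: (@app_linear_at _ _ _ _ _ (j - a.-1)).
- lia.
- apply: (linear_at_ext (F := fun u : n.-tuple U => nth 0 u j));
    last exact: nth_linear_at.
  by move=> u; rewrite nth_slice ?subnKC //; lia.
- move=> k km kj.
  apply: (const_at_ext (F := fun u : n.-tuple U => nth 0 u (a.-1 + k))).
    by move=> u; rewrite nth_slice //; lia.
  by apply: nth_const_at; lia.
Qed.

Lemma slice_const_at n m (f : multihom U V m) a b (j : 'I_n) :
  (a.-1 + m <= b)%N -> ~~ (a.-1 <= j < a.-1 + m)%N ->
  const_at j (fun u => app f (slice u a b)).
Proof.
move=> mb aj; apply: app_const_at => k km.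
apply: (const_at_ext (F := fun u : n.-tuple U => nth 0 u (a.-1 + k))).
  by move=> u; rewrite nth_slice //; lia.
by apply: nth_const_at; lia.
Qed.

(* Replacing the p entries following the first i ones by [X u]. *)
Lemma splice_linear_at n m (f : multihom U V m) (X : n.-tuple U -> U)
    i p c b (j : 'I_n) :
  (i < m)%N -> (i <= n)%N -> (m + p = n.+1)%N -> c.-1 = (i + p)%N ->
  (n <= b)%N ->
  ((i <= j < i + p)%N -> linear_at j X) ->
  (~~ (i <= j < i + p)%N -> const_at j X) ->
  linear_at j (fun u => app f (slice u 1 i ++ X u :: slice u c b)).
Proof.
move=> im iln mp cE nb Xl Xc.
have sz (u : n.-tuple U) : size (slice u 1 i) = i.
  by rewrite /slice drop0 size_take size_tuple; case: ltnP; lia.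
have E (u : n.-tuple U) k : (k < m)%N ->
    nth 0 (slice u 1 i ++ X u :: slice u c b) k =
    if (k < i)%N then nth 0 u k else
    if k == i then X u else nth 0 u (k + p).-1.
  move=> km; rewrite nth_cat sz; case: ltnP => ki; first by rewrite nth_slice.
  case: eqP => [->|kni]; first by rewrite subnn.
  have -> : (k - i)%N = (k - i).-1.+1 by lia.
  by rewrite /= nth_slice; [congr nth|]; lia.
pose q := (if (j < i)%N then nat_of_ord j else
           if (j < i + p)%N then i else (j - p).+1)%N.
apply: (@app_linear_at _ _ _ _ _ q).
- rewrite /q; have := ltn_ord j; do 2?[case: ifP]; lia.
- apply: (linear_at_ext (fun u => esym (E u q _))).
    by rewrite /q; have := ltn_ord j; do 2?[case: ifP]; lia.
  rewrite /q; have jn := ltn_ord j; case: (ltnP j i) => ji.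
    by rewrite ji; exact: nth_linear_at.
  case: (ltnP j (i + p)%N) => jp.
    by rewrite ltnn eqxx; apply: Xl; rewrite ji.
  case: ltnP; first lia.
  by case: eqP => [|_ _]; [lia | apply: nth_linear_at; lia].
- move=> k km kq.
  apply: (const_at_ext (fun u => esym (E u k km))).
  move: kq; rewrite /q => kq; have jn := ltn_ord j.
  case: ltnP => ki; first by apply: nth_const_at; move: kq; do 2?[case: ifP]; lia.
  case: eqP => [ke|kni].
    by apply: Xc; move: kq; do 2?[case: ifP]; lia.
  by apply: nth_const_at; move: kq; do 2?[case: ifP]; lia.
Qed.

End MultilinearTheory.

Section ControllingAlgebra.
Variables (K : fieldType) (A A' : lmodType K).
Variables (mulA : {bilinear A -> A -> A}) (mulA' : {bilinear A' -> A' -> A'}).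
Variables (rho mu : {bilinear A -> A' -> A'}).
Variables (eta xi : {bilinear A' -> A -> A}).

Local Notation hom := (multihom A' A).

(** Below, [s] is (u_1, ..., u_n) with n = m1 + m2, resp. n = m + 1. *)

Definition bracket_fun m1 m2 (f1 : hom m1) (f2 : hom m2) (s : seq A') : A :=
  mulA (app f2 (slice s 1 m2)) (app f1 (slice s m2.+1 (m1 + m2)))
  - (-1) ^+ (m1 * m2) *:
      mulA (app f1 (slice s 1 m1)) (app f2 (slice s m1.+1 (m1 + m2)))
  + \sum_(1 <= i < m1.+1) (-1) ^+ (i * m2) *:
      app f1 (slice s 1 i.-1
              ++ mu (app f2 (slice s i.+1 (i + m2))) (entry s i)
              :: slice s (i + m2).+1 (m1 + m2))
  - \sum_(1 <= i < m1.+1) (-1) ^+ (i.-1 * m2) *: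
      app f1 (slice s 1 i.-1
              ++ rho (app f2 (slice s i (i + m2).-1)) (entry s (i + m2))
              :: slice s (i + m2).+1 (m1 + m2))
  + (-1) ^+ (m1 * m2) *: \sum_(1 <= i < m2.+1) (-1) ^+ (i.-1 * m1) *:
      app f2 (slice s 1 i.-1
              ++ rho (app f1 (slice s i (i + m1).-1)) (entry s (i + m1))
              :: slice s (i + m1).+1 (m1 + m2))
  - (-1) ^+ (m1 * m2.+1) *: \sum_(1 <= i < m2.+1) (-1) ^+ (i.-1 * m1) *:
      app f2 (slice s 1 i.-1
              ++ mu (app f1 (slice s i.+1 (i + m1))) (entry s i)
              :: slice s (i + m1).+1 (m1 + m2)).

(** The factor (-1)^(m-1) is written (-1)^(m+1), to avoid truncated
    subtraction. *)
Definition diff_fun m (f : hom m) (s : seq A') : A :=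
  xi (entry s m.+1) (app f (slice s 1 m))
  + (-1) ^+ m.+1 *: eta (entry s 1) (app f (slice s 2 m.+1))
  + (-1) ^+ m.+1 *: \sum_(1 <= i < m.+1) (-1) ^+ i *:
      app f (slice s 1 i.-1
             ++ mulA' (entry s i) (entry s i.+1)
             :: slice s i.+2 m.+1).

Lemma mu_splice m1 m2 n (e : (m1 + m2)%N = n) (f1 : hom m1) (f2 : hom m2)
    i (j : 'I_n) b : (1 <= i < m1.+1)%N -> b = n ->
  linear_at j (fun u : n.-tuple A' =>
    app f1 (slice u 1 i.-1
              ++ mu (app f2 (slice u i.+1 (i + m2))) (entry u i)
              :: slice u (i + m2).+1 b)).
Proof.
move=> iI bn.
apply: (@splice_linear_at _ _ _ _ _ _ _ _ m2.+1); try lia.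
- move=> jI; apply: linear_at_bil; case: (eqVneq i.-1 j) => ij; [right|left].
    by split; [apply: slice_const_at; lia | apply: nth_linear_at].
  by split; [apply: slice_linear_at; lia | apply: nth_const_at; apply/eqP].
- move=> jI; apply: const_at_bil; last by apply: nth_const_at; lia.
  by apply: slice_const_at; lia.
Qed.

Lemma rho_splice m1 m2 n (e : (m1 + m2)%N = n) (f1 : hom m1) (f2 : hom m2)
    i (j : 'I_n) b : (1 <= i < m1.+1)%N -> b = n ->
  linear_at j (fun u : n.-tuple A' =>
    app f1 (slice u 1 i.-1
              ++ rho (app f2 (slice u i (i + m2).-1)) (entry u (i + m2))
              :: slice u (i + m2).+1 b)).
Proof.
move=> iI bn.
apply: (@splice_linear_at _ _ _ _ _ _ _ _ m2.+1); try lia.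
- move=> jI; apply: linear_at_bil; case: (eqVneq (i + m2).-1 j) => ij; [right|left].
    by split; [apply: slice_const_at; lia | apply: nth_linear_at].
  by split; [apply: slice_linear_at; lia | apply: nth_const_at; apply/eqP].
- move=> jI; apply: const_at_bil; last by apply: nth_const_at; lia.
  by apply: slice_const_at; lia.
Qed.

Lemma bracket_multilinear m1 m2 n (e : (m1 + m2)%N = n) (f1 : hom m1)
    (f2 : hom m2) :
  (fun u : n.-tuple A' => bracket_fun f1 f2 u) \in @multilinear K A' A n.
Proof.
apply/asboolP => j; have jn := ltn_ord j.
do 5?[apply: linear_atD].
- apply: linear_at_bil; case: (ltnP j m2) => jm; [left|right].
    by split; [apply: slice_linear_at; lia | apply: slice_const_at; lia].
  by split; [apply: slice_const_at; lia | apply: slice_linear_at; lia].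
- apply/linear_atN/linear_atZ/linear_at_bil; case: (ltnP j m1) => jm; [left|right].
    by split; [apply: slice_linear_at; lia | apply: slice_const_at; lia].
  by split; [apply: slice_const_at; lia | apply: slice_linear_at; lia].
- by apply: linear_at_sum => i iI; apply/linear_atZ/mu_splice.
- by apply/linear_atN/linear_at_sum => i iI; apply/linear_atZ/rho_splice.
- apply/linear_atZ/linear_at_sum => i iI.
  by apply/linear_atZ/rho_splice => //; rewrite addnC.
- apply/linear_atN/linear_atZ/linear_at_sum => i iI.
  by apply/linear_atZ/mu_splice => //; rewrite addnC.
Qed.

Lemma diff_multilinear m n (e : m.+1 = n) (f : hom m) :
  (fun u : n.-tuple A' => diff_fun f u) \in @multilinear K A' A n.
Proof.
apply/asboolP => j; have jn := ltn_ord j.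
do 2?[apply: linear_atD].
- apply: linear_at_bil; case: (ltnP j m) => jm; [right|left].
    by split; [apply: nth_const_at; lia | apply: slice_linear_at; lia].
  by split; [apply: nth_linear_at; lia | apply: slice_const_at; lia].
- apply/linear_atZ/linear_at_bil; case: (ltnP 0 j) => jm; [right|left].
    by split; [apply: nth_const_at; lia | apply: slice_linear_at; lia].
  by split; [apply: nth_linear_at; lia | apply: slice_const_at; lia].
- apply/linear_atZ/linear_at_sum => i iI; apply: linear_atZ.
  apply: (@splice_linear_at _ _ _ _ _ _ _ _ 2); try lia.
  + move=> jI; apply: linear_at_bil; case: (eqVneq i.-1 j) => ij; [left|right].
      by split; [apply: nth_linear_at | apply: nth_const_at; lia].
    by split; [apply: nth_const_at; lia | apply: nth_linear_at; lia].
  + by move=> jI; apply: const_at_bil; apply: nth_const_at; lia.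
Qed.

Definition hom_bracket m1 m2 n (e : (m1 + m2)%N = n) (f1 : hom m1)
    (f2 : hom m2) : hom n :=
  Multihom (bracket_multilinear e f1 f2).

Definition hom_diff m n (e : m.+1 = n) (f : hom m) : hom n :=
  Multihom (diff_multilinear e f).

(** The graded vector space of the Hom(A'^{(x) n+1}, A), n >= 0, with
    Hom(A'^{(x) n+1}, A) in degree n. *)
Definition graded_hom (i : int) : lmodType K :=
  match i with
  | Posz n => hom n.+1
  | Negz _ => 'rV[K]_0
  end.

Lemma degB (m1 m2 n : nat) :
  (m1%:Z + 1) + (m2%:Z + 1) = n%:Z + 1 -> (m1.+1 + m2.+1)%N = n.+1.
Proof. lia. Qed.

Lemma degD (m n : nat) : (m%:Z + 1) + 1 = n%:Z + 1 -> m.+2 = n.+1.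
Proof. lia. Qed.

(** [i], [j], [k] are degrees before suspension. *)
Definition shifted_bracket (i j k : int) :
    (i + 1) + (j + 1) = k + 1 -> graded_hom i -> graded_hom j -> graded_hom k :=
  match i, j, k return
    (i + 1) + (j + 1) = k + 1 -> graded_hom i -> graded_hom j -> graded_hom k
  with
  | Posz m1, Posz m2, Posz n => fun e f1 f2 => hom_bracket (degB e) f1 f2
  | _, _, _ => fun _ _ _ => 0
  end.

Definition shifted_diff (i j : int) :
    (i + 1) + 1 = j + 1 -> graded_hom i -> graded_hom j :=
  match i, j return (i + 1) + 1 = j + 1 -> graded_hom i -> graded_hom j with
  | Posz m, Posz n => fun e f => hom_diff (degD e) f
  | _, _ => fun _ _ => 0
  end.

Lemma suspB (i j k : int) :
  i + j = k -> (i - 1 + 1) + (j - 1 + 1) = k - 1 + 1.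
Proof. by rewrite !subrK. Qed.

Lemma suspD (i j : int) : i + 1 = j -> (i - 1 + 1) + 1 = j - 1 + 1.
Proof. by rewrite !subrK. Qed.

Definition mp_bracket : graded_bracket (suspension graded_hom) :=
  fun i j k e => shifted_bracket (suspB e).

Definition mp_diff : graded_differential (suspension graded_hom) :=
  fun i j e => shifted_diff (suspD e).

Lemma linear_multilinear (B : {linear A' -> A}) :
  (fun u : 1.-tuple A' => B (thead u)) \in @multilinear K A' A 1.
Proof.
apply/asboolP => j u a x y.
by rewrite /thead !tnth_mktuple !ord1 !eqxx linearP.
Qed.

Definition hom_of_linear (B : {linear A' -> A}) : hom 1 :=
  Multihom (linear_multilinear B).

End ControllingAlgebra.

(* Main.v *)
Require Import Defs.
From HB Require Import structures.
From mathcomp Require Import all_boot all_order all_algebra.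
From mathcomp Require Import boolp functions zify.
Set Implicit Arguments.
Unset Strict Implicit.
Unset Printing Implicit Defensive.
Import GRing.Theory.
Local Open Scope ring_scope.

(** The controlling algebra is an instance of the derived bracket construction.

    Let [V] be the sum of [A] and [A'].  Multilinear cochains on [V] with values
    in [V], graded by arity minus one, form a graded Lie algebra under the
    Gerstenhaber bracket [gbr]; its Jacobi identity comes from the pre-Lie
    identity [circ_circ] of the insertion product.  The six structure maps of a
    matched pair assemble into two binary cochains: D gathers [mulA], [rho]
    and [mu], and E gathers [mulA'], [eta] and [xi].  Their sum is the
    multiplication of the bicrossed product, and the matched pair axioms say
    that [D,D] = 0, [E,E] = 0 and [E,D] = 0 ([bowtieA_square],
    [bowtieA'_square], [bowtie_anticommute]).

    A cochain f in Hom(A'^m, A) extends to a cochain [hat f] on [V] that reads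
    only the [A'] components of its arguments and takes its values in [A].  Two
    such cochains cannot be inserted into one another, so their brackets
    vanish.  Up to this embedding, the differential and the bracket of the
    theorem are
      d f = [E, f]   and   {f, g} = (-1)^(m-1) [[D, f], g]
    for f of arity m ([hat_diff], [hat_bracket]).  The axioms then follow
    formally: {f, g} is graded antisymmetric because [f, g] = 0, the Jacobi
    identity uses [D,D] = 0, d is a derivation because [E,D] = 0, and d o d = 0
    because [E,E] = 0; the characteristic enters through 2 [D, [D, f]] =
    [[D,D], f].

    The Maurer-Cartan equation lives in arity 2, where the curvature of a linear
    map B, evaluated at (u, v), is the difference of the two sides of the
    equation of a deformation map ([app_curvature]). *)

(** * The insertion product of cochains *)

Lemma drop_take T n m (s : seq T) : drop n (take m s) = take (m - n) (drop n s).
Proof.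
case: (leqP n m) => nm; first by rewrite take_drop subnK.
have -> : (m - n = 0)%N by lia.
by rewrite take0 drop_oversize // size_take; case: ltnP; lia.
Qed.

Section PreLie.
Variables (K : fieldType) (V : lmodType K).
Implicit Types (f g h : seq V -> V) (s : seq V).

(** Cochains are functions on words of all lengths, so that no degree equation
    occurs in their types.  The arity of a cochain is carried separately, as the
    degree argument (arity minus one) of the operations below. *)
Definition entry_linear f := forall a c, linear (fun x => f (a ++ x :: c)).

(** The Gerstenhaber insertion of g, of arity [q.+1], into f; the length of the
    word determines the number of positions. *)
Definition circ q f g : seq V -> V := fun s =>
  \sum_(0 <= i < size s - q) (-1) ^+ (i * q) *:
    f (take i s ++ g (take q.+1 (drop i s)) :: drop (i + q.+1) s).

(** The insertions of g and h at two positions of f, with g on the left.  [i]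
    and [j] are positions among the arguments of f, whence the shift of [j] by
    [q], the length that g adds to the word. *)
Definition circ_apart q r f g h : seq V -> V := fun s =>
  \sum_(0 <= i < size s - (q + r)) \sum_(i.+1 <= j < size s - (q + r))
    (-1) ^+ (i * q + j * r) *:
    f (take i s ++ g (take q.+1 (drop i s)) :: take (j - i.+1) (drop (i + q.+1) s)
       ++ h (take r.+1 (drop (j + q) s)) :: drop (j + q + r.+1) s).

Lemma entry_linear_sum f a c m n (F : nat -> V) (k : nat -> K) : entry_linear f ->
  f (a ++ (\sum_(m <= i < n) k i *: F i) :: c) =
  \sum_(m <= i < n) k i *: f (a ++ F i :: c).
Proof.
move=> fl; pose L : V -> V := fun x => f (a ++ x :: c).
have L0 : L 0 = 0 by have := fl a c (-1) 0 0; rewrite !scaler0 add0r scaleN1r addNr.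
rewrite -/(L _) (big_morph L (id1 := 0) (op1 := +%R)) //.
  by apply: eq_bigr => i _; have := fl a c (k i) (F i) 0; rewrite -!/(L _) L0 !addr0.
by move=> x y; have := fl a c 1 x y; rewrite -!/(L _) !scale1r.
Qed.

(** The pre-Lie identity.  After g, the cochain h is inserted either into an
    argument of g, which gives the iterated insertion, or into an argument of f
    to the right or to the left of g.  The last two cases are exchanged by
    exchanging g and h, up to the sign by which h moves across g. *)
Lemma circ_circ q r f g h : entry_linear f ->
  circ r (circ q f g) h =
  circ (q + r) f (circ r g h) + (-1) ^+ (q * r) *: circ_apart q r f g h
  + circ_apart r q f h g.
Proof.
move=> fl; apply/funext => s; rewrite !fctE /circ_apart (addnC r q).
set N := size s.
(* [w j] is the word s after h has been applied from position j on; [t i j] is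
   the value of f when g is moreover applied from position i of [w j] on. *)
pose w j := take j s ++ h (take r.+1 (drop j s)) :: drop (j + r.+1) s.
pose t i j := f (take i (w j) ++ g (take q.+1 (drop i (w j))) :: drop (i + q.+1) (w j)).
have szw j : (j < N - r)%N -> size (w j) = (N - r)%N.
  move=> jr; rewrite size_cat /= size_take size_drop -/N; case: ltnP; lia.
have -> : circ r (circ q f g) h s = \sum_(0 <= i < N - (q + r))
    \sum_(0 <= j < N - r) (-1) ^+ (i * q + j * r) *: t i j.
  rewrite exchange_big_nat /=; apply: eq_big_nat => j /andP[_ jr].
  rewrite {1}/circ -/(w j) szw // scaler_sumr -subnDA (addnC r).
  by apply: eq_bigr => i _; rewrite scalerA mulrC -exprD.
have tw i j : (j <= N)%N -> take i (w j) = if (i <= j)%N then take i s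
    else take j s ++ h (take r.+1 (drop j s)) :: take (i - j.+1) (drop (j + r.+1) s).
  move=> jN; rewrite take_cat size_takel //; case: ltnP => ij.
    by rewrite (ltnW ij) take_takel // ltnW.
  case: leqP => ij'.
    by rewrite (_ : i = j) ?subnn ?take0 ?cats0 //; lia.
  by have -> : (i - j = (i - j.+1).+1)%N by lia.
have dw i j : (j <= N)%N -> drop i (w j) = if (i <= j)%N then
    take (j - i) (drop i s) ++ h (take r.+1 (drop j s)) :: drop (j + r.+1) s
    else drop (i + r) s.
  move=> jN; rewrite drop_cat size_takel //; case: ltnP => ij.
    by rewrite (ltnW ij) -[in take j s](subnKC (ltnW ij)) addnC -take_drop.
  case: leqP => ij'.
    by rewrite (_ : i = j) ?subnn ?take0 //; lia.
  have -> : (i - j = (i - j.+1).+1)%N by lia.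
  by rewrite /= drop_drop; congr drop; lia.
(* For g at position i, h lies within g, to its right, or to its left. *)
transitivity (\sum_(0 <= i < N - (q + r))
   (\sum_(i <= j < i + q.+1) (-1) ^+ (i * q + j * r) *: t i j
   + \sum_(i + q.+1 <= j < N - r) (-1) ^+ (i * q + j * r) *: t i j
   + \sum_(0 <= j < i) (-1) ^+ (i * q + j * r) *: t i j)).
  apply: eq_big_nat => i /andP[_ iM].
  rewrite [LHS](@big_cat_nat _ _ _ i) //=; last lia.
  by rewrite addrC; congr (_ + _); rewrite (@big_cat_nat _ _ _ (i + q.+1)) //=; lia.
rewrite !big_split /=; congr (_ + _ + _).
- apply: eq_big_nat => i /andP[_ iM].
  rewrite -{1}[i]add0n big_addn addKn /circ entry_linear_sum //.
  rewrite size_takel ?size_drop; last by rewrite -/N; lia.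
  have -> : ((q + r).+1 - r = q.+1)%N by lia.
  rewrite scaler_sumr; apply: eq_big_nat => k kq.
  rewrite scalerA -exprD; congr (_ ^+ _ *: _); first lia.
  rewrite /t tw ?dw; try lia.
  rewrite leq_addl; congr (f (_ ++ g _ :: _)); last first.
    by case: leqP => [|_]; [lia | congr drop; lia].
  rewrite addnK take_cat size_takel ?size_drop -/N; last lia.
  case: ltnP => [|_]; first lia.
  have -> : (q.+1 - k = (q - k).+1)%N by lia.
  rewrite /= take_takel; last lia.
  rewrite !drop_take !drop_drop.
  congr (_ ++ h _ :: _).
    by rewrite take_takel; [congr (take _ (drop _ s)) | ]; lia.
  by congr (take _ (drop _ s)); lia.
- rewrite scaler_sumr; apply: eq_big_nat => i /andP[_ iM].
  rewrite -[X in \sum_(X <= j < _) _]addSnnS big_addn.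
  rewrite (_ : N - r - q = N - (q + r))%N; last lia.
  rewrite scaler_sumr; apply: eq_big_nat => j /andP[ij jM].
  rewrite scalerA -exprD; congr (_ ^+ _ *: _); first by rewrite mulnDl; lia.
  rewrite /t tw 2?dw; try lia.
  rewrite (_ : i <= j + q)%N; last lia.
  rewrite (_ : i + q.+1 <= j + q)%N; last lia.
  rewrite (_ : j + q - (i + q.+1) = j - i.+1)%N; last lia.
  congr (f (_ ++ g _ :: _)).
  by rewrite takel_cat ?take_takel // ?size_takel ?size_drop -/N; lia.
- transitivity (\sum_(0 <= i < N - (q + r)) \sum_(0 <= j < N - (q + r) | (j < i)%N)
      (-1) ^+ (i * q + j * r) *: t i j).
    by apply: eq_big_nat => i /andP[_ /ltnW iM]; rewrite (big_nat_widen _ _ _ _ _ iM).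
  rewrite (exchange_big_dep_nat xpredT) //=; apply: eq_big_nat => j /andP[_ jM].
  rewrite [RHS](big_nat_widenl _ 0%N) //; apply: congr_big_nat => // i /andP[ji /andP[_ iM]].
  rewrite addnC; congr (_ *: _); rewrite /t tw ?dw; try lia.
  rewrite leqNgt ji /= (_ : i + q.+1 <= j = false)%N; last lia.
  rewrite -catA cat_cons; congr (f (_ ++ _ :: _ ++ g (take _ (drop _ _)) :: drop _ _)); lia.
Qed.

Lemma circ_linearl q g : linear (circ q ^~ g).
Proof.
move=> a f f'; apply/funext => s; rewrite !fctE /circ scaler_sumr -big_split /=.
by apply: eq_bigr => i _; rewrite scalerDr !scalerA mulrC.
Qed.

Lemma circ_linearr q f : entry_linear f -> linear (circ q f).
Proof.
move=> fl a g g'; apply/funext => s; rewrite !fctE /circ scaler_sumr -big_split /=.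
by apply: eq_bigr => i _; rewrite fl scalerDr !scalerA mulrC.
Qed.

Lemma entry_linearP a f g : entry_linear f -> entry_linear g -> entry_linear (a *: f + g).
Proof.
move=> fl gl b c k x y; rewrite !fctE fl gl !scalerDr !scalerA mulrC.
by rewrite -!addrA; congr (_ + _); rewrite addrCA.
Qed.

Lemma entry_linear_circ q f g : entry_linear f -> entry_linear g ->
  entry_linear (circ q f g).
Proof.
move=> fl gl a c k x y; rewrite /circ !size_cat /= scaler_sumr -big_split /=.
apply: eq_big_nat => i /andP[_ iM].
rewrite scalerA mulrC -scalerA -scalerDr; congr (_ *: _).
case: (ltnP i (size a)) => [ia|ai].
  rewrite !take_cat !drop_cat !ia.
  case: (ltnP (i + q.+1) (size a)) => [qa|aq].
    rewrite !take_cat size_drop (_ : q.+1 < size a - i)%N; last lia.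
    have := fl (take i a ++ g (take q.+1 (drop i a)) :: drop (i + q.+1) a) c k x y.
    by rewrite -!catA.
  rewrite !take_cat size_drop (_ : q.+1 < size a - i = false)%N; last lia.
  case E: (i + q.+1 - size a)%N => [|n].
    have -> : (q.+1 - (size a - i) = 0)%N by lia.
    rewrite !take0 !cats0.
    by have := fl (take i a ++ [:: g (drop i a)]) c k x y; rewrite -!catA.
  have -> : (q.+1 - (size a - i) = n.+1)%N by lia.
  by rewrite /= gl fl.
rewrite !take_cat !drop_cat !(ltnNge i) !ai /=.
rewrite (_ : i + q.+1 < size a = false)%N; last lia.
have -> : (i + q.+1 - size a = (i - size a + q).+1)%N by lia.
case: (i - size a)%N => [|n] /=; first by rewrite cats0 (gl [::] (take q c) k x y) fl.
have := fl a (take n c ++ g (take q.+1 (drop n c)) :: drop (n.+1 + q) c) k x y.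
by rewrite -!catA.
Qed.

(** The Gerstenhaber bracket of cochains of degrees p and q. *)
Definition gbr p q f g : seq V -> V := circ q f g - (-1) ^+ (p * q) *: circ p g f.

Lemma entry_linear_gbr p q f g : entry_linear f -> entry_linear g ->
  entry_linear (gbr p q f g).
Proof.
move=> fl gl; rewrite /gbr addrC -scaleNr.
by apply: entry_linearP; apply: entry_linear_circ.
Qed.

Lemma gbr_linearl p q g : entry_linear g -> linear (gbr p q ^~ g).
Proof.
move=> gl a f f'; rewrite /gbr circ_linearl circ_linearr //.
by rewrite scalerDr opprD addrACA !scalerBr !scalerA (mulrC a).
Qed.

Lemma gbr_linearr p q f : entry_linear f -> linear (gbr p q f).
Proof.
move=> gl a g g'; rewrite /gbr circ_linearl circ_linearr //.
by rewrite scalerDr opprD addrACA !scalerBr !scalerA (mulrC a).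
Qed.

Lemma gbr_antisym p q f g : gbr p q f g = - ((-1) ^+ (p * q) *: gbr q p g f).
Proof.
rewrite /gbr scalerBr scalerA (mulnC q p) -expr2 sqrr_sign scale1r.
by rewrite opprB.
Qed.

End PreLie.

(** [zmod_cancel] proves an equality of signed sums in an abelian group by
    cancelling opposite terms in pairs.  Terms are compared up to conversion, as
    the same vector may be typed in different algebraic structures. *)
Ltac pull y :=
  match goal with
  | |- ?x + (?z + _) = 0 => unify z y
  | |- ?x + ?z = 0 => unify z y
  | |- context [?a + (?z + ?b)] => unify z y; rewrite (addrCA a z b); pull y
  | |- context [?a + ?z] => unify z y; rewrite (addrC a z); pull y
  end.

Ltac zmod_cancel :=
  apply: subr0_eq; rewrite ?subr0 ?opprD ?opprK -?addrA;
  repeat match goal with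
  | |- - ?x + _ = 0 => pull x; rewrite ?addKr ?addNr
  | |- ?x + _ = 0 =>
    match goal with |- context [- ?z] => unify z x; pull (- z) end;
    rewrite ?addNKr ?subrr
  end; try reflexivity.

(** * The graded Lie algebra of cochains *)

Section GLA.
Variables (K : fieldType) (V : lmodType K).
Implicit Types (f g h : seq V -> V) (s : seq V).

(** The right action of cochains by insertion is an action of the Gerstenhaber
    bracket: in the pre-Lie identity the terms [circ_apart] are symmetric in g
    and h up to sign, hence cancel. *)
Lemma circ_gbr q r f g h : entry_linear f ->
  circ (q + r) f (gbr q r g h) =
  circ r (circ q f g) h - (-1) ^+ (q * r) *: circ q (circ r f h) g.
Proof.
move=> fl; rewrite (circ_circ q r) // (circ_circ r q) //.
rewrite /gbr addrC -scaleNr circ_linearr // (addnC r q) (mulnC r q).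
rewrite !scalerDr !scalerA -expr2 sqrr_sign scale1r scaleNr.
zmod_cancel.
Qed.

Lemma circZBl k a f g h : circ k (f - a *: g) h = circ k f h - a *: circ k g h.
Proof. by rewrite addrC -scaleNr circ_linearl scaleNr addrC. Qed.

Lemma circZBr k a f g h : entry_linear f ->
  circ k f (g - a *: h) = circ k f g - a *: circ k f h.
Proof. by move=> fl; rewrite addrC -scaleNr circ_linearr // scaleNr addrC. Qed.

Lemma circ0l k g : circ k 0 g = 0 :> (seq V -> V).
Proof. by have := circZBl k 1 0 0 g; rewrite !scale1r !subrr. Qed.

(** By [circ_gbr], each double bracket expands into four iterated insertions,
    and the twelve terms cancel. *)
Lemma gbr_jacobi p q r f g h : entry_linear f -> entry_linear g -> entry_linear h ->
  gbr p (q + r) f (gbr q r g h) =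
  gbr (p + q) r (gbr p q f g) h + (-1) ^+ (p * q) *: gbr q (p + r) g (gbr p r f h).
Proof.
move=> fl gl hl.
rewrite [LHS]/gbr [gbr (p + q) _ _ _]/gbr [gbr q (p + r) _ _]/gbr !circ_gbr //.
rewrite {1 2 3}/gbr !circZBl !mulnDr !mulnDl !exprD (mulnC q p).
rewrite !scalerBr !scalerA.
have sq n : (-1) ^+ n * (-1) ^+ n = 1 :> K by rewrite -expr2 sqrr_sign.
set a := (-1) ^+ (p * q); set b := (-1) ^+ (q * r); set c := (-1) ^+ (p * r).
by rewrite (mulrA a a) sq mul1r (mulrC b c) (mulrAC c b a) (mulrC c a); zmod_cancel.
Qed.

Lemma gbr0l p q g : entry_linear g -> gbr p q 0 g = 0 :> (seq V -> V).
Proof.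
move=> gl; have := gbr_linearl p q gl (-1) 0 0.
by rewrite scaler0 addr0 scaleN1r addNr.
Qed.

Lemma gbrZl p q a f g : entry_linear g -> gbr p q (a *: f) g = a *: gbr p q f g.
Proof. by move=> gl; have := gbr_linearl p q gl a f 0; rewrite gbr0l ?addr0. Qed.

Lemma gbr0r p q f : entry_linear f -> gbr p q f 0 = 0 :> (seq V -> V).
Proof.
move=> fl; have := gbr_linearr p q fl (-1) 0 0.
by rewrite scaler0 addr0 scaleN1r addNr.
Qed.

Lemma gbrZr p q a f g : entry_linear f -> gbr p q f (a *: g) = a *: gbr p q f g.
Proof. by move=> fl; have := gbr_linearr p q fl a g 0; rewrite gbr0r ?addr0. Qed.

(** The Jacobi identity for an element of degree 1, which acts as an odd
    derivation of the bracket. *)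
Lemma gbr_derivation p q D f g : entry_linear D -> entry_linear f -> entry_linear g ->
  gbr 1 (p + q) D (gbr p q f g) =
  gbr p.+1 q (gbr 1 p D f) g + (-1) ^+ p *: gbr p q.+1 f (gbr 1 q D g).
Proof. by move=> Dl fl gl; rewrite gbr_jacobi // !add1n mul1n. Qed.

Lemma gbr_anticommute p D E f : entry_linear D -> entry_linear E -> entry_linear f ->
  gbr 1 1 D E = 0 -> gbr 1 p.+1 D (gbr 1 p E f) = - gbr 1 p.+1 E (gbr 1 p D f).
Proof.
move=> Dl El fl DE; rewrite -(add1n p) gbr_derivation // DE gbr0l // add0r.
by rewrite expr1 scaleN1r add1n.
Qed.

(** Jacobi only gives 2 [D, [D, f]] = [[D, D], f]. *)
Lemma gbr_square0 p D f : [pchar K] =i pred0 -> entry_linear D -> entry_linear f ->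
  gbr 1 1 D D = 0 -> gbr 1 p.+1 D (gbr 1 p D f) = 0.
Proof.
move=> charK0 Dl fl DD; have /eqP := gbr_anticommute p Dl Dl fl DD.
by rewrite -addr_eq0 -mulr2n -scaler_nat scaler_eq0 (pcharf0P K).1 //= => /eqP.
Qed.

(** * Derived brackets *)

Section Derived.
Variables (D E : seq V -> V).
Hypotheses (charK0 : [pchar K] =i pred0).
Hypotheses (Dl : entry_linear D) (El : entry_linear E).
Hypotheses (DD : gbr 1 1 D D = 0) (ED : gbr 1 1 E D = 0).

(** The normalization (-1)^p makes the derived bracket graded antisymmetric for
    the degrees p + 1. *)
Definition derived p q f g := (-1) ^+ p *: gbr p.+1 q (gbr 1 p D f) g.

Lemma derived_linearl p q g : entry_linear g -> linear (fun f => derived p q f g).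
Proof.
move=> gl a f f'; rewrite /derived gbr_linearr // gbr_linearl //.
by rewrite scalerDr !scalerA mulrC.
Qed.

Lemma derived_linearr p q f : entry_linear f -> linear (derived p q f).
Proof.
move=> fl a g g'; rewrite /derived gbr_linearr; last exact: entry_linear_gbr.
by rewrite scalerDr !scalerA mulrC.
Qed.
(** Apply the derivation [D, -] to [f, g] = 0: it yields
    [[D, f], g] = - (-1)^p [f, [D, g]]. *)
Lemma derived_antisym p q f g : entry_linear f -> entry_linear g -> gbr p q f g = 0 ->
  derived p q f g = - ((-1) ^+ (p.+1 * q.+1) *: derived q p g f).
Proof.
move=> fl gl fg; have := gbr_derivation p q Dl fl gl.
rewrite fg gbr0r // => /esym /eqP; rewrite addr_eq0 => /eqP e.
rewrite /derived e gbr_antisym scalerA !scalerN opprK !scalerA.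
rewrite -scaleNr -expr2 sqrr_sign mul1r; congr (_ *: _).
by rewrite mulSn exprD exprS mulN1r !mulNr opprK mulrAC -expr2 sqrr_sign mul1r.
Qed.

(** This is the Jacobi identity for [D, f], [D, g] and h, since
    [D, [[D, f], g]] = (-1)^(p+1) [[D, f], [D, g]] when [D, [D, f]] = 0. *)
Lemma derived_jacobi p q r f g h : entry_linear f -> entry_linear g -> entry_linear h ->
  derived p (q.+1 + r) f (derived q r g h) =
  derived (p.+1 + q) r (derived p q f g) h +
  (-1) ^+ (p.+1 * q.+1) *: derived q (p.+1 + r) g (derived p r f h).
Proof.
move=> fl gl hl; have Df0 := gbr_square0 p charK0 Dl fl DD.
have bl := @entry_linear_gbr K V.
have Fl := bl 1%N p _ _ Dl fl; have Gl := bl 1%N q _ _ Dl gl.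
rewrite /derived !(gbrZr, gbrZl) //.
rewrite gbr_jacobi // gbr_derivation // Df0 gbr0l // add0r gbrZl //.
rewrite -addnS 2!scalerDr !scalerA; congr (_ *: _ + _ *: _).
  by rewrite addSn !exprS exprD !mulN1r mulrN mulrNN -expr2 sqrr_sign mulr1.
by rewrite mulrC [X in _ * X]mulrC mulrA.
Qed.

(** [E, -] is an odd derivation which anticommutes with [D, -]. *)
Lemma derived_leibniz p q f g : entry_linear f -> entry_linear g ->
  gbr 1 (p.+1 + q) E (derived p q f g) =
  derived p.+1 q (gbr 1 p E f) g + (-1) ^+ p.+1 *: derived p q.+1 f (gbr 1 q E g).
Proof.
move=> fl gl.
have Fl := entry_linear_gbr 1 p Dl fl.
rewrite /derived gbrZr // gbr_derivation // gbr_anticommute //.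
rewrite -scaleN1r gbrZl // scalerDr !scalerA.
by congr (_ *: _ + _ *: _); rewrite -?exprSr // mulrC.
Qed.

(** The only insertions that survive for elements of an abelian subalgebra
    absorbing the insertion of D: the two values of D at f and g, and the
    insertion of [circ q D g] into f and of [circ p D f] into g. *)
Lemma derivedE p q f g : entry_linear f -> entry_linear g ->
  circ q f g = 0 -> circ p.+1 g (circ 1 f D) = 0 -> circ q.+1 f (circ 1 g D) = 0 ->
  derived p q f g = (-1) ^+ p *: circ q (circ p D f) g
    - circ q.+1 f (circ q D g) - (-1) ^+ (p + p.+1 * q) *: circ p.+1 g (circ p D f).
Proof.
move=> fl gl fg0 gfD0 fgD0.
have fDg : circ q (circ 1 f D) g = circ q.+1 f (circ q D g).
  have := circ_gbr 1 q D g fl.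
  by rewrite fg0 circ0l scaler0 subr0 add1n /gbr circZBr // fgD0 scaler0 subr0.
rewrite /derived /gbr mul1n circZBl circZBr // gfD0 scaler0 subr0 fDg.
by rewrite !scalerBr !scalerA -expr2 sqrr_sign scale1r exprD.
Qed.
End Derived.
End GLA.

(** * Binary cochains and supports *)

Section Binary.
Variables (K : fieldType) (V : lmodType K).
Implicit Types (m : V -> V -> V) (F G : seq V -> V) (s : seq V).

Definition binary m : seq V -> V := fun s => if s is [:: x; y] then m x y else 0.

(** Cochains of arity n are extended by zero to words of other lengths, so that
    equality of functions on all words is equality of cochains. *)
Definition supported n F := forall s, size s != n -> F s = 0.

Lemma supported_binary m : supported 2 (binary m).
Proof. by case=> [|x [|y [|z s]]]. Qed.

Lemma supported_circ q n F G : supported n F -> supported (n + q) (circ q F G).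
Proof.
move=> Fn s sn; rewrite /circ big_nat big1 // => i /andP[_ iM].
by rewrite Fn ?scaler0 // size_cat /= size_drop size_take; case: ltnP; lia.
Qed.

Lemma supportedB n a F G : supported n F -> supported n G -> supported n (F - a *: G).
Proof. by move=> Fn Gn s sn; rewrite !fctE Fn // Gn // scaler0 subr0. Qed.

Lemma supportedZ n a F : supported n F -> supported n (a *: F).
Proof. by move=> Fn s sn; rewrite !fctE Fn // scaler0. Qed.

Lemma supported_gbr p q F G : supported p.+1 F -> supported q.+1 G ->
  supported (p + q).+1 (gbr p q F G).
Proof.
move=> Fp Gq; apply: supportedB; first by rewrite -addSn; exact: supported_circ.
by rewrite addnC -addSn; exact: supported_circ.
Qed.

Lemma supported_ext n F G : supported n F -> supported n G ->
  (forall s, size s = n -> F s = G s) -> F = G.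
Proof.
move=> Fn Gn FG; apply/funext => s.
by have [/eqP/FG //|sn] := boolP (size s == n); rewrite Fn // Gn.
Qed.

Lemma entry_linear_binary m : (forall y, linear (m ^~ y)) -> (forall x, linear (m x)) ->
  entry_linear (binary m).
Proof.
move=> ml mr [|b [|c [|d a]]] [|e [|f l]] k x y //=;
  by rewrite ?ml ?mr ?scaler0 ?addr0.
Qed.

Lemma circ_binary m p F s : size s = p.+2 ->
  circ p (binary m) F s = m (F (take p.+1 s)) (nth 0 s p.+1) +
    (-1) ^+ p *: m (nth 0 s 0) (F (drop 1 s)).
Proof.
case: s => // x s [ss]; rewrite /circ (_ : size (x :: s) - p = 2)%N /=; last lia.
rewrite big_nat_recl // big_nat1 mul0n expr0 scale1r mul1n /=.
rewrite (drop_nth 0 (n := p)) ?ss // add0n !(drop_oversize (n := p.+1)) ?ss //.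
by rewrite take0 drop0 -ss take_size.
Qed.

Lemma circ_binary2 m m' :
  circ 1 (binary m) (binary m') =
  fun s => if s is [:: x; y; z] then m (m' x y) z - m x (m' y z) else 0.
Proof.
apply/funext => s; have [/eqP ss|ss] := boolP (size s == 3); last first.
  rewrite (supported_circ _ (@supported_binary m)) //.
  by move: s ss; do 4?[case=> [|? ] //].
rewrite circ_binary //; move: s ss; do 4?[case=> [|? ] //].
by rewrite /= expr1 scaleN1r.
Qed.

(** The bracket of two products is their mutual associator. *)
Lemma gbr_binary m m' :
  (forall x y z, m (m' x y) z - m x (m' y z) + (m' (m x y) z - m' x (m y z)) = 0) ->
  gbr 1 1 (binary m) (binary m') = 0.
Proof.
move=> mm; rewrite /gbr expr1 scaleN1r opprK !circ_binary2; apply/funext => s.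
by case: s => [|x [|y [|z [|t s]]]]; rewrite !fctE ?addr0 //; apply: mm.
Qed.
End Binary.

(** * The cochains on A' with values in A *)

Section Hat.
Variables (K : fieldType) (A A' : lmodType K).
Local Notation V := ((A * A')%type : lmodType K).
Local Notation hom := (multihom A' A).

Lemma app_tuple n (f : hom n) (u : n.-tuple A') : app f u = f u.
Proof.
by congr (f _); apply: eq_from_tnth => k; rewrite tnth_mktuple (tnth_nth 0).
Qed.

Lemma app_linear n (f : hom n) a c : (size a + (size c).+1)%N = n ->
  linear (fun x => app f (a ++ x :: c)).
Proof.
move=> e; have an : (size a < n)%N by lia.
pose t := [tuple nth 0 (a ++ 0 :: c) k | k < n].
have E x : app f (a ++ x :: c) = f (upd t (Ordinal an) x).
  congr (f _); apply: eq_from_tnth => k; rewrite !tnth_mktuple !nth_cat -val_eqE /=.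
  case: ltngtP => [ak|ak|->]; [by []| |by rewrite subnn].
  by rewrite -[(k - _)%N]prednK ?subn_gt0.
by move=> b x y; rewrite !E multihom_linear_at.
Qed.

Lemma combination0 (W : lmodType K) (k : K) : k *: 0 + 0 = 0 :> W.
Proof. by rewrite scaler0 addr0. Qed.

Definition hat n (f : hom n) : seq V -> V := fun s =>
  if size s == n then (app f (map snd s), 0) else (0 : V).

Lemma hatE n (f : hom n) s : size s = n -> hat f s = (app f (map snd s), 0).
Proof. by rewrite /hat => ->; rewrite eqxx. Qed.

Lemma supported_hat n (f : hom n) : supported n (hat f).
Proof. by move=> s /negPf sn; rewrite /hat sn. Qed.

Lemma entry_linear_hat n (f : hom n) : entry_linear (hat f).
Proof.
move=> a c k x y; rewrite /hat !size_cat /=; case: eqP => [e|_]; last first.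
  exact/esym/combination0.
rewrite !map_cat /= app_linear ?size_map //.
by congr (_, _); exact/esym/combination0.
Qed.

Lemma hat_linear n k (f g : hom n) : hat (k *: f + g) = k *: hat f + hat g.
Proof.
apply/funext => s; rewrite !fctE /hat; case: eqP => _; last exact/esym/combination0.
by congr (_, _); exact/esym/combination0.
Qed.

Lemma hat0 n : hat (0 : hom n) = 0.
Proof.
by have := hat_linear (-1) (0 : hom n) 0; rewrite !scaleN1r !addNr.
Qed.

Lemma hatZ n k (f : hom n) : hat (k *: f) = k *: hat f.
Proof. by rewrite -[k *: f]addr0 hat_linear hat0 addr0. Qed.

Lemma hatN n (f : hom n) : hat (- f) = - hat f.
Proof. by rewrite -!scaleN1r hatZ. Qed.

Lemma hatD n (f g : hom n) : hat (f + g) = hat f + hat g.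
Proof. by rewrite -[f]scale1r hat_linear !scale1r. Qed.

Lemma hat_inj n : injective (@hat n).
Proof.
move=> f g fg; apply/val_inj/funext => u.
have := congr1 (fun F => (F [seq (0, x) | x <- u]).1) fg.
by rewrite /hat size_map size_tuple eqxx /= -map_comp map_id_in // !app_tuple.
Qed.

Lemma hat_snd n (f : hom n) s : (hat f s).2 = 0.
Proof. by rewrite /hat; case: eqP. Qed.

(** An argument in [A] has no [A'] component for f to read. *)
Lemma hat_zero n (f : hom n) a x c : x.2 = 0 -> hat f (a ++ x :: c) = 0.
Proof.
move=> x0; have /= := entry_linear_hat f a c (-1) x x.
rewrite !scaleN1r !addNr => e.
by rewrite -[RHS]e /hat !size_cat !map_cat /= x0.
Qed.

Lemma circ_hat0 q n (f : hom n) G : (forall s, (G s).2 = 0) -> circ q (hat f) G = 0.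
Proof.
move=> G0; apply/funext => s; rewrite /circ big1 // => i _.
by rewrite hat_zero ?scaler0.
Qed.

(** Insertion into [hat f] again takes its values in [A]. *)
Lemma circ_hat_snd q n (f : hom n) G s : (circ q (hat f) G s).2 = 0.
Proof.
rewrite /circ (big_morph snd (id1 := 0) (op1 := +%R)) // big1 // => i _ /=.
by rewrite hat_snd scaler0.
Qed.

End Hat.

(** * The two halves of the bicrossed product *)

Section Bowtie.
Variables (K : fieldType) (A A' : lmodType K).
Variables (mulA : {bilinear A -> A -> A}) (mulA' : {bilinear A' -> A' -> A'}).
Variables (rho mu : {bilinear A -> A' -> A'}).
Variables (eta xi : {bilinear A' -> A -> A}).
Local Notation V := (A * A')%type.
Local Notation hom := (multihom A' A).

(** [bowtieA] collects the products in which a factor of [A] acts, and [bowtieA']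
    those in which a factor of [A'] acts: their sum is the product of the
    bicrossed product algebra on the sum of [A] and [A']. *)
Definition bowtieA (x y : V) : V := (mulA x.1 y.1, rho x.1 y.2 + mu y.1 x.2).
Definition bowtieA' (x y : V) : V := (xi y.2 x.1 + eta x.2 y.1, mulA' x.2 y.2).
Local Notation D1 := (binary bowtieA).
Local Notation D0 := (binary bowtieA').

Lemma entry_linear_bowtieA : entry_linear D1.
Proof.
apply: entry_linear_binary => z k x y; congr (_, _); rewrite ?linearPl ?linearPr //=.
  by rewrite scalerDr addrACA.
by rewrite scalerDr addrACA.
Qed.

Lemma entry_linear_bowtieA' : entry_linear D0.
Proof.
apply: entry_linear_binary => z k x y; congr (_, _); rewrite ?linearPl ?linearPr //=.
  by rewrite scalerDr addrACA.
by rewrite scalerDr addrACA.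
Qed.

Hypothesis mp : matched_pair mulA mulA' rho mu eta xi.

(** Associativity of [bowtieA] says that [mulA] is associative and that
    ([rho], [mu]) is a representation. *)
Lemma bowtieA_square : gbr 1 1 D1 D1 = 0.
Proof.
have [assoc _ [rM muM rmu] _ _ _ _ _ _ _] := mp.
have E x y z : bowtieA (bowtieA x y) z = bowtieA x (bowtieA y z).
  congr (_, _) => /=; first by rewrite assoc.
  by rewrite rM muM !linearDr /= rmu addrA.
by apply: gbr_binary => x y z; rewrite !E !subrr addr0.
Qed.

Lemma bowtieA'_square : gbr 1 1 D0 D0 = 0.
Proof.
have [_ assoc _ [eM xM ex] _ _ _ _ _ _] := mp.
have E x y z : bowtieA' (bowtieA' x y) z = bowtieA' x (bowtieA' y z).
  congr (_, _) => /=; last by rewrite assoc.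
  by rewrite eM xM !linearDr /= ex addrA.
by apply: gbr_binary => x y z; rewrite !E !subrr addr0.
Qed.

(** The [A] component encodes the three compatibility axioms with two elements
    of [A], and the [A'] component those with two elements of [A']. *)
Lemma bowtie_anticommute : gbr 1 1 D0 D1 = 0.
Proof.
have [_ _ _ _ mr mm me mx ml mxr] := mp.
apply: gbr_binary => x y z; congr (_, _) => /=.
  by rewrite !linearDr !linearDl /= mx me (canRL (addrK _) (mxr _ _ _)); zmod_cancel.
by rewrite !linearDr !linearDl /= mr mm (canRL (addrK _) (ml _ _ _)); zmod_cancel.
Qed.
End Bowtie.

(** * The explicit operations as derived brackets *)

Section Explicit.
Variables (K : fieldType) (A A' : lmodType K).
Variables (mulA : {bilinear A -> A -> A}) (mulA' : {bilinear A' -> A' -> A'}).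
Variables (rho mu : {bilinear A -> A' -> A'}).
Variables (eta xi : {bilinear A' -> A -> A}).
Local Notation V := (A * A')%type.
Local Notation hom := (multihom A' A).
Local Notation D1 := (binary (bowtieA mulA rho mu)).
Local Notation D0 := (binary (bowtieA' mulA' eta xi)).

Lemma tuple_of_nth n (u : seq A') : size u = n -> [tuple nth 0 u k | k < n] = u :> seq A'.
Proof.
move=> un; apply: (@eq_from_nth _ 0) => [|i]; rewrite size_tuple // => iltn.
by rewrite -[i]/(val (Ordinal iltn)) -tnth_nth tnth_mktuple.
Qed.

Lemma circ_hat_fst p q (f : hom p.+1) G s : size s = (p.+1 + q)%N ->
  (circ q (hat f) G s).1 = \sum_(0 <= i < p.+1) (-1) ^+ (i * q) *:
    app f (take i (map snd s) ++ (G (take q.+1 (drop i s))).2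
           :: drop (i + q.+1) (map snd s)).
Proof.
move=> ss; rewrite /circ ss addnK (big_morph fst (id1 := 0) (op1 := +%R)) //.
apply: eq_big_nat => i /andP[_ ip]; rewrite hatE; last first.
  by rewrite size_cat /= size_drop size_takel ss; lia.
by rewrite /= map_cat /= map_take map_drop.
Qed.

(** A term in which [hat g] falls into an argument of [hat f] vanishes, so g must
    be the other factor of the product. *)
Lemma circ_circ_binary_hat m p q (f : hom p.+1) (g : hom q.+1) (s : seq V) :
  (forall x, m 0 x = 0) -> (forall x, m x 0 = 0) -> size s = (p.+1 + q.+1)%N ->
  circ q (circ p (binary m) (hat f)) (hat g) s =
  (-1) ^+ (p.+1 * q) *: m (hat f (take p.+1 s)) (hat g (drop p.+1 s)) +
  (-1) ^+ p *: m (hat g (take q.+1 s)) (hat f (drop q.+1 s)).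
Proof.
move=> m0l m0r ss; rewrite {1}/circ (_ : size s - q = p.+2)%N; last (rewrite ss; lia).
pose w i := take i s ++ hat g (take q.+1 (drop i s)) :: drop (i + q.+1) s.
transitivity (\sum_(0 <= i < p.+2)
   ((-1) ^+ (i * q) *: m (hat f (take p.+1 (w i))) (nth 0 (w i) p.+1)
   + (-1) ^+ (i * q) *: ((-1) ^+ p *: m (nth 0 (w i) 0) (hat f (drop 1 (w i)))))).
  apply: eq_big_nat => i /andP[_ ip]; rewrite circ_binary ?scalerDr //.
  by rewrite size_cat /= size_drop size_takel ss; lia.
rewrite big_split; congr (_ + _).
  rewrite big_nat_recr //= big_nat big1 ?add0r => [|i /andP[_ ip]].
    rewrite /w take_size_cat ?size_takel ?ss; try lia.
    rewrite nth_cat size_takel; last (rewrite ss; lia).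
    by rewrite ltnn subnn /= [take q.+1 (drop _ _)]take_oversize // size_drop ss; lia.
  rewrite /w take_cat size_takel; last (rewrite ss; lia).
  rewrite ltnNge (ltnW ip) /= subSn //=.
  by rewrite hat_zero ?hat_snd // m0l scaler0.
rewrite big_nat_recl //= big_nat big1 ?addr0 => [|i /andP[_ ip]].
  by rewrite /w mul0n take0 /= expr0 scale1r !drop0 add0n.
rewrite /w; case: s ss {w} => //= x s ss.
by rewrite drop0 hat_zero ?hat_snd // m0r !scaler0.
Qed.

Lemma nth_snd (s : seq V) i : nth 0 (map snd s) i = (nth 0 s i).2.
Proof.
case: (ltnP i (size s)) => si; first by rewrite (nth_map 0).
by rewrite !nth_default ?size_map.
Qed.

Lemma app_hom_diff m n (e : m.+1 = n) (f : hom m) u : size u = n ->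
  app (hom_diff mulA' eta xi e f) u = diff_fun mulA' eta xi f u.
Proof. by move=> un; rewrite /app /= tuple_of_nth. Qed.

Lemma app_hom_bracket m1 m2 n (e : (m1 + m2)%N = n) (f : hom m1) (g : hom m2) u :
  size u = n -> app (hom_bracket mulA rho mu e f g) u = bracket_fun mulA rho mu f g u.
Proof. by move=> un; rewrite /app /= tuple_of_nth. Qed.

Lemma slice_prefix (u : seq A') k : slice u 1 k = take k u.
Proof. exact: drop0. Qed.

Lemma slice_suffix (u : seq A') k n : size u = n -> slice u k.+1 n = drop k u.
Proof. by move=> <-; rewrite /slice take_size. Qed.

Lemma slice_take (u : seq A') k m : slice u k.+1 (k + m) = take m (drop k u).
Proof. by rewrite /slice take_drop addnC. Qed.

Lemma take2_drop (T : Type) x0 (s : seq T) i : (i.+1 < size s)%N ->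
  take 2 (drop i s) = [:: nth x0 s i; nth x0 s i.+1].
Proof.
move=> si; rewrite (drop_nth x0) ?(ltnW si) // (drop_nth x0 si) /=.
by rewrite take0.
Qed.

(** [circ p D0 (hat f)] gives the terms in [xi] and [eta], and
    [circ 1 (hat f) D0] those in [mulA']. *)
Lemma hat_diff p n (e : p.+2 = n) (f : hom p.+1) :
  hat (hom_diff mulA' eta xi e f) = gbr 1 p D0 (hat f).
Proof.
subst n; apply: (supported_ext (n := p.+2)); first exact: supported_hat.
  by apply: (@supported_gbr _ _ 1 p); [exact: supported_binary | exact: supported_hat].
move=> s ss; rewrite hatE // app_hom_diff ?size_map // /gbr !fctE mul1n circ_binary //.
rewrite !hatE ?size_takel ?size_drop ?ss // [RHS]surjective_pairing.
congr (_, _) => /=; last first.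
  by rewrite linear0l linear0r circ_hat_snd !scaler0 subr0 addr0.
rewrite circ_hat_fst; last by rewrite ss addn1.
rewrite !(linear0l, linear0r) add0r addr0 /diff_fun.
have un : size (map snd s) = p.+2 by rewrite size_map.
rewrite !slice_prefix slice_suffix // map_take map_drop /entry !nth_snd.
have -> : (-1) ^+ p.+2 = (-1) ^+ p :> K by rewrite !exprS !mulN1r opprK.
congr (_ + _); rewrite -scalerN -sumrN big_add1; congr (_ *: _).
apply: eq_big_nat => i /andP[_ ip].
rewrite exprS mulN1r scaleNr muln1 slice_prefix slice_suffix // (take2_drop 0) ?ss //=.
by rewrite !nth_snd addn2.
Qed.

(** [rho_sum] and [mu_sum] are the inner sums of the bracket, with positions
    counted from 0 and with the same sign. *)
Definition rho_sum p q (f : hom p.+1) (g : hom q.+1) (u : seq A') : A :=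
  \sum_(0 <= i < p.+1) (-1) ^+ (i * q.+1) *:
    app f (take i u ++ rho (app g (take q.+1 (drop i u))) (nth 0 u (i + q.+1))
           :: drop (i + q.+2) u).

Definition mu_sum p q (f : hom p.+1) (g : hom q.+1) (u : seq A') : A :=
  \sum_(0 <= i < p.+1) (-1) ^+ (i * q.+1) *:
    app f (take i u ++ mu (app g (take q.+1 (drop i.+1 u))) (nth 0 u i)
           :: drop (i + q.+2) u).

(** The signs of the six groups of terms for [m1 = p.+1] and [m2 = q.+1], in the
    form in which [derivedE] produces them. *)
Lemma bracket_funE p q (f : hom p.+1) (g : hom q.+1) u :
  size u = (p.+1 + q.+1)%N ->
  bracket_fun mulA rho mu f g u =
  mulA (app g (take q.+1 u)) (app f (drop q.+1 u))
  + (-1) ^+ (p + p.+1 * q) *: mulA (app f (take p.+1 u)) (app g (drop p.+1 u))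
  - (rho_sum f g u + (-1) ^+ q *: mu_sum f g u)
  - (-1) ^+ (p + p.+1 * q) *: (rho_sum g f u + (-1) ^+ p *: mu_sum g f u).
Proof.
move=> un; rewrite /bracket_fun !slice_prefix !slice_suffix //.
have rhoE k m (h1 : hom k.+1) (h2 : hom m.+1) :
    \sum_(1 <= i < k.+2) (-1) ^+ (i.-1 * m.+1) *: app h1 (slice u 1 i.-1
      ++ rho (app h2 (slice u i (i + m.+1).-1)) (entry u (i + m.+1))
      :: slice u (i + m.+1).+1 (p.+1 + q.+1)) = rho_sum h1 h2 u.
  rewrite big_add1; apply: eq_bigr => i _.
  by rewrite slice_prefix (slice_suffix _ un) addSn /= slice_take (addnS i m.+1).
have muE k m (h1 : hom k.+1) (h2 : hom m.+1) :
    \sum_(1 <= i < k.+2) (-1) ^+ (i.-1 * m.+1) *: app h1 (slice u 1 i.-1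
      ++ mu (app h2 (slice u i.+1 (i + m.+1))) (entry u i)
      :: slice u (i + m.+1).+1 (p.+1 + q.+1)) = mu_sum h1 h2 u.
  rewrite big_add1; apply: eq_bigr => i _.
  by rewrite slice_prefix (slice_suffix _ un) slice_take addSnnS.
rewrite !rhoE muE (_ : \sum_(1 <= i < p.+2) _ = (-1) ^+ q.+1 *: mu_sum f g u); last first.
  rewrite -muE scaler_sumr; apply: eq_big_nat => -[|i] // _.
  by rewrite scalerA -exprD mulSn.
rewrite scalerDr scalerA -exprD (_ : p + p.+1 * q + p = p.*2 + p.+1 * q)%N; last lia.
rewrite (_ : p.+1 * q.+1 = (p + p.+1 * q).+1)%N; last by rewrite mulnS addSn.
rewrite (_ : p.+1 * q.+2 = p.*2 + (p.+1 * q).+2)%N; last by rewrite !mulnS; lia.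
rewrite !(exprD _ p.*2) (_ : (-1) ^+ p.*2 = 1 :> K) ?mul1r; last first.
  by rewrite -signr_odd odd_double.
rewrite !exprS !mulN1r opprK !scaleNr.
zmod_cancel.
Qed.

(** On a word of length [q.+2], the [A'] component of [circ q D1 (hat g)] is a
    [rho] term at the last letter plus a [mu] term at the first one. *)
Lemma circ_hat_bowtieA p q (f : hom p.+1) (g : hom q.+1) (s : seq V) :
  size s = (p.+1 + q.+1)%N ->
  circ q.+1 (hat f) (circ q D1 (hat g)) s =
  (rho_sum f g (map snd s) + (-1) ^+ q *: mu_sum f g (map snd s), 0).
Proof.
move=> ss; rewrite [LHS]surjective_pairing circ_hat_snd circ_hat_fst //.
congr (_, _); rewrite scaler_sumr -big_split; apply: eq_big_nat => i /andP[_ ip] /=.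
rewrite circ_binary; last by rewrite size_takel // size_drop ss; lia.
rewrite take_takel // drop_take !drop_drop add1n subn1 /=.
rewrite !hatE ?size_takel ?size_drop ?ss; try lia.
rewrite /= linear0r linear0r add0r addr0.
rewrite !nth_take // !nth_drop addn0 !map_take !map_drop -!nth_snd.
rewrite [X in _ ++ X :: _]addrC app_linear.
  by rewrite scalerDr addrC !scalerA mulrC.
by rewrite size_takel ?size_drop size_map ss; lia.
Qed.

Lemma hat_bracket p q n (e : (p.+1 + q.+1)%N = n) (f : hom p.+1) (g : hom q.+1) :
  hat (hom_bracket mulA rho mu e f g) = derived D1 p q (hat f) (hat g).
Proof.
subst n; apply: (supported_ext (n := (p.+1 + q.+1)%N)); first exact: supported_hat.
  rewrite addnS; apply/supportedZ/(@supported_gbr _ _ p.+1 q); last exact: supported_hat.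
  by apply: (@supported_gbr _ _ 1 p); [exact: supported_binary | exact: supported_hat].
move=> s ss; rewrite derivedE; try exact: entry_linear_hat; last first.
- by apply: circ_hat0 => t; exact: circ_hat_snd.
- by apply: circ_hat0 => t; exact: circ_hat_snd.
- by apply: circ_hat0; exact: hat_snd.
rewrite hatE // app_hom_bracket ?size_map // bracket_funE ?size_map // !fctE.
rewrite circ_circ_binary_hat //;
  try by move=> x; congr (_, _); rewrite !(linear0l, linear0r) ?addr0.
rewrite !circ_hat_bowtieA // ?(addnC q.+1) //.
rewrite !hatE ?size_takel ?size_drop ?ss ?addKn ?addnK; try lia.
congr (_, _) => /=.
  rewrite !map_take !map_drop; congr (_ - _ - _ *: _).
  by rewrite scalerDr !scalerA -exprD -expr2 sqrr_sign scale1r addrC.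
by rewrite !linear0r !addr0 !scaler0 !addr0 !scaler0 !subr0.
Qed.
End Explicit.

(** * The differential graded Lie algebra *)

Section ControllingDgla.
Variables (K : fieldType) (charK0 : [pchar K] =i pred0) (A A' : lmodType K).
Variables (mulA : {bilinear A -> A -> A}) (mulA' : {bilinear A' -> A' -> A'}).
Variables (rho mu : {bilinear A -> A' -> A'}).
Variables (eta xi : {bilinear A' -> A -> A}).
Hypothesis mp : matched_pair mulA mulA' rho mu eta xi.
Local Notation gh := (@graded_hom K A A').
Local Notation sbr := (@shifted_bracket K A A' mulA rho mu).
Local Notation sd := (@shifted_diff K A A' mulA' eta xi).
Local Notation sl1 := (entry_linear_bowtieA mulA rho mu).
Local Notation sl0 := (entry_linear_bowtieA' mulA' eta xi).

(** The lemmas below are about degrees before suspension, where the components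
    are indexed by constructors of [int].  Either a degree is negative, and both
    sides are zero, or the identity holds after applying the injection [hat]. *)
Lemma shifted_linearl i j k (e : (i + 1) + (j + 1) = k + 1) (y : gh j) :
  linear (fun x : gh i => sbr e x y).
Proof.
case: i j k e y => [p|?] [q|?] [n|?] e y a x x'; try by rewrite /= scaler0 addr0.
apply: hat_inj; rewrite /= hat_linear !hat_bracket hat_linear derived_linearl //.
  exact: sl1.
exact: entry_linear_hat.
Qed.

Lemma shifted_linearr i j k (e : (i + 1) + (j + 1) = k + 1) (x : gh i) :
  linear (sbr e x).
Proof.
case: i j k e x => [p|?] [q|?] [n|?] e x a y y'; try by rewrite /= scaler0 addr0.
apply: hat_inj; rewrite /= hat_linear !hat_bracket hat_linear derived_linearr //.
  exact: sl1.
exact: entry_linear_hat.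
Qed.

Lemma shifted0l i j k (e : (i + 1) + (j + 1) = k + 1) (y : gh j) : sbr e 0 y = 0.
Proof. by have := shifted_linearl e y (-1) 0 0; rewrite !scaleN1r !addNr. Qed.

Lemma shifted0r i j k (e : (i + 1) + (j + 1) = k + 1) (x : gh i) : sbr e x 0 = 0.
Proof. by have := shifted_linearr e x (-1) 0 0; rewrite !scaleN1r !addNr. Qed.

Lemma shifted_diff_linear i j (e : (i + 1) + 1 = j + 1) : linear (sd e).
Proof.
case: i j e => [p|?] [n|?] e a x x'; try by rewrite /= scaler0 addr0.
apply: hat_inj; rewrite /= hat_linear !hat_diff hat_linear gbr_linearr //.
exact: sl0.
Qed.

Lemma shifted_diff0 i j (e : (i + 1) + 1 = j + 1) : sd e 0 = 0.
Proof. by have := shifted_diff_linear e (-1) 0 0; rewrite !scaleN1r !addNr. Qed.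

Lemma sign_suspension m n : (-1) ^ ((m%:Z + 1) * (n%:Z + 1)) = (-1) ^+ (m.+1 * n.+1) :> K.
Proof. by rewrite -!PoszD !addn1 -PoszM. Qed.

Lemma shifted_antisym i j k (e : (i + 1) + (j + 1) = k + 1)
    (e' : (j + 1) + (i + 1) = k + 1) (x : gh i) (y : gh j) :
  sbr e x y = - ((-1) ^ ((i + 1) * (j + 1)) *: sbr e' y x).
Proof.
case: i j k e e' x y => [p|?] [q|?] [n|?] e e' x y;
  try by rewrite /= scaler0 oppr0.
rewrite sign_suspension; apply: hat_inj; rewrite /= hatN hatZ !hat_bracket.
apply: derived_antisym; try exact: entry_linear_hat; first exact: sl1.
by rewrite /gbr !circ_hat0 ?scaler0 ?subr0 //; exact: hat_snd.
Qed.

Lemma negative_zero i (x : gh (Negz i)) : x = 0.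
Proof. exact: thinmx0. Qed.

Lemma shifted_jacobi i j k ij jk ik n
      (eij : (i + 1) + (j + 1) = ij + 1) (ejk : (j + 1) + (k + 1) = jk + 1)
      (eik : (i + 1) + (k + 1) = ik + 1)
      (e1 : (i + 1) + (jk + 1) = n + 1) (e2 : (ij + 1) + (k + 1) = n + 1)
      (e3 : (j + 1) + (ik + 1) = n + 1) (x : gh i) (y : gh j) (z : gh k) :
    sbr e1 x (sbr ejk y z) = sbr e2 (sbr eij x y) z +
      (-1) ^ ((i + 1) * (j + 1)) *: sbr e3 y (sbr eik x z).
Proof.
have z0 : x = 0 \/ y = 0 \/ z = 0 -> sbr e1 x (sbr ejk y z) = sbr e2 (sbr eij x y) z +
      (-1) ^ ((i + 1) * (j + 1)) *: sbr e3 y (sbr eik x z).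
  by case=> [|[]] ->; rewrite !(shifted0l, shifted0r) scaler0 addr0.
move: z0; case: i eij eik e1 x => [p|?] eij eik e1 x; last first.
  by apply; left; exact: negative_zero.
case: j eij ejk e3 y => [q|?] eij ejk e3 y; last first.
  by apply; right; left; exact: negative_zero.
case: k ejk eik e2 z => [r|?] ejk eik e2 z; last first.
  by apply; right; right; exact: negative_zero.
move=> _; case: ij eij e2 => [ij|?] eij e2; last by exfalso; lia.
case: jk ejk e1 => [jk|?] ejk e1; last by exfalso; lia.
case: ik eik e3 => [ik|?] eik e3; last by exfalso; lia.
case: n e1 e2 e3 => [n|?] e1 e2 e3; last by exfalso; lia.
have Eij : ij = (p.+1 + q)%N by lia.
have Ejk : jk = (q.+1 + r)%N by lia.
have Eik : ik = (p.+1 + r)%N by lia.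
subst ij jk ik; rewrite sign_suspension; apply: hat_inj.
rewrite /= hatD hatZ !hat_bracket.
have fl (m : nat) (f : multihom A' A m) := entry_linear_hat f.
apply: derived_jacobi => //; [exact: sl1 | exact: bowtieA_square mp].
Qed.

Lemma shifted_dd i j k (e1 : (i + 1) + 1 = j + 1) (e2 : (j + 1) + 1 = k + 1) (x : gh i) :
  sd e2 (sd e1 x) = 0.
Proof.
case: i j k e1 e2 x => [p|?] [q|?] [n|?] e1 e2 x //; last by rewrite shifted_diff0.
have Eq : q = p.+1 by lia.
subst q; apply: hat_inj; rewrite /= !hat_diff hat0.
apply: gbr_square0 => //; [exact: sl0 | exact: entry_linear_hat | exact: bowtieA'_square mp].
Qed.

Lemma shifted_leibniz i j k i' j' k' (e : (i + 1) + (j + 1) = k + 1)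
      (ei : (i + 1) + 1 = i' + 1) (ej : (j + 1) + 1 = j' + 1) (ek : (k + 1) + 1 = k' + 1)
      (e1 : (i' + 1) + (j + 1) = k' + 1) (e2 : (i + 1) + (j' + 1) = k' + 1)
      (x : gh i) (y : gh j) :
    sd ek (sbr e x y) =
      sbr e1 (sd ei x) y + (-1) ^ (i + 1) *: sbr e2 x (sd ej y).
Proof.
have z0 : x = 0 \/ y = 0 -> sd ek (sbr e x y) =
      sbr e1 (sd ei x) y + (-1) ^ (i + 1) *: sbr e2 x (sd ej y).
  by case=> ->; rewrite !(shifted0l, shifted0r, shifted_diff0) scaler0 addr0.
move: z0; case: i e ei e2 x => [p|?] e ei e2 x; last first.
  by apply; left; exact: negative_zero.
case: j e ej e1 y => [q|?] e ej e1 y; last first.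
  by apply; right; exact: negative_zero.
move=> _; case: k e ek => [k|?] e ek; last by exfalso; lia.
case: i' ei e1 => [i'|?] ei e1; last by exfalso; lia.
case: j' ej e2 => [j'|?] ej e2; last by exfalso; lia.
case: k' ek e1 e2 => [k'|?] ek e1 e2; last by exfalso; lia.
have Ek : k = (p.+1 + q)%N by lia.
have Ei : i' = p.+1 by lia.
have Ej : j' = q.+1 by lia.
subst k i' j'; rewrite -PoszD addn1; apply: hat_inj.
rewrite /= hatD hatZ !(hat_diff, hat_bracket).
apply: derived_leibniz; try exact: entry_linear_hat; [exact: sl1 | exact: sl0 |].
exact: bowtie_anticommute mp.
Qed.

Lemma mp_dgla : is_dgla (mp_bracket mulA rho mu) (mp_diff mulA' eta xi).
Proof.
split.
- by move=> i j k e y; exact: shifted_linearl.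
- by move=> i j k e x; exact: shifted_linearr.
- move=> i j k e e' x y.
  have -> : (-1) ^ (i * j) = (-1) ^ ((i - 1 + 1) * (j - 1 + 1)) :> K by rewrite !subrK.
  exact: shifted_antisym.
- move=> i j k ij jk ik n eij ejk eik e1 e2 e3 x y z.
  have -> : (-1) ^ (i * j) = (-1) ^ ((i - 1 + 1) * (j - 1 + 1)) :> K by rewrite !subrK.
  exact: shifted_jacobi.
- by move=> i j e; exact: shifted_diff_linear.
- by move=> *; exact: shifted_dd.
- move=> i j k i' j' k' e ei ej ek e1 e2 x y.
  have -> : (-1) ^ i = (-1) ^ (i - 1 + 1) :> K by rewrite subrK.
  exact: shifted_leibniz.
Qed.
End ControllingDgla.

(** * Maurer-Cartan elements *)

Section MC.
Variables (K : fieldType) (charK0 : [pchar K] =i pred0) (A A' : lmodType K).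
Variables (mulA : {bilinear A -> A -> A}) (mulA' : {bilinear A' -> A' -> A'}).
Variables (rho mu : {bilinear A -> A' -> A'}).
Variables (eta xi : {bilinear A' -> A -> A}).
Local Notation hom := (multihom A' A).
Local Notation hbr := (hom_bracket mulA rho mu).
Local Notation hd := (hom_diff mulA' eta xi).

(** The bracket of x with itself produces each of its terms twice, which the
    factor 1/2 compensates. *)
Lemma app_curvature (e : (1 + 1)%N = 2%N) (e' : 2%N = 2%N) (x : hom 1) u v :
  app (hd e' x + 2%:R^-1 *: hbr e x x) [:: u; v] =
  (mulA (app x [:: u]) (app x [:: v]) + xi v (app x [:: u]) + eta u (app x [:: v]))
  - app x [:: mulA' u v + rho (app x [:: u]) v + mu (app x [:: v]) u].
Proof.
have two0 : 2%:R != 0 :> K by rewrite (pcharf0P K).1.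
have xD a b : app x [:: a + b] = app x [:: a] + app x [:: b].
  by have := app_linear x (a := [::]) (c := [::]) erefl 1 a b; rewrite !scale1r.
rewrite -[LHS]/(app (hd e' x) [:: u; v] + 2%:R^-1 *: app (hbr e x x) [:: u; v]).
rewrite app_hom_diff // app_hom_bracket // /diff_fun /bracket_fun.
rewrite !big_nat1 /=.
rewrite /entry /slice /= !mul0n !mul1n expr2 !expr1 expr0 mulrNN mulr1.
rewrite !scale1r !scaleN1r !opprK.
set ab := mulA _ _; set am := app x [:: mu _ _]; set ar := app x [:: rho _ _].
rewrite (_ : ab + ab - am - ar - ar - am = 2%:R *: (ab - am - ar)); last first.
  by rewrite scaler_nat mulr2n; zmod_cancel.
rewrite scalerA mulVf // scale1r !xD.
zmod_cancel.
Qed.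

Lemma maurer_cartanP (x : suspension (graded_hom A A') 1) :
  maurer_cartan (mp_bracket mulA rho mu) (mp_diff mulA' eta xi) x <->
     exists2 B : {linear A' -> A},
       deformation_map mulA mulA' rho mu eta xi B & x = hom_of_linear B.
Proof.
pose e1 : (1 + 1)%N = 2%N := degB (@suspB 1 1 2 erefl).
pose e2 : 2%N = 2%N := degD (@suspD 1 2 erefl).
pose c : hom 2 := hd e2 (x : hom 1) + 2%:R^-1 *: hbr e1 (x : hom 1) (x : hom 1).
rewrite /maurer_cartan -[X in X = 0]/c.
have cP : c = 0 <-> forall u v, app c [:: u; v] = 0.
  split=> [-> //|c0]; apply/val_inj/funext => t; rewrite -[LHS]app_tuple.
  by case: t => -[|u [|v []]] // ?; exact: c0.
rewrite cP; split=> [c0|[B Bdef xB] u v]; last first.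
  have xE w : app (x : hom 1) [:: w] = B w.
    by rewrite xB /app /= /thead tnth_mktuple.
  by rewrite app_curvature !xE Bdef subrr.
have Bl : linear (fun w => app (x : hom 1) [:: w]).
  exact: (app_linear (x : hom 1) (a := [::]) (c := [::]) erefl).
pose B : {linear A' -> A} := HB.pack (fun w => app (x : hom 1) [:: w])
  (GRing.isLinear.Build K A' A *:%R _ Bl).
exists B => [u v|].
  by apply: subr0_eq; rewrite -[RHS](c0 u v) app_curvature.
apply/val_inj/funext => t; rewrite -[LHS]app_tuple /=.
by case: t => -[|u []] // ?; rewrite /B /=.
Qed.
End MC.

Theorem corollary4p14 (K : fieldType) (charK0 : [pchar K] =i pred0)
    (A A' : lmodType K)
    (mulA : {bilinear A -> A -> A}) (mulA' : {bilinear A' -> A' -> A'})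
    (rho mu : {bilinear A -> A' -> A'}) (eta xi : {bilinear A' -> A -> A})
    (mp : matched_pair mulA mulA' rho mu eta xi) :
  is_dgla (mp_bracket mulA rho mu) (mp_diff mulA' eta xi) /\
  (forall x : suspension (graded_hom A A') 1,
     maurer_cartan (mp_bracket mulA rho mu) (mp_diff mulA' eta xi) x <->
     exists2 B : {linear A' -> A},
       deformation_map mulA mulA' rho mu eta xi B & x = hom_of_linear B).
Proof. by split; [exact: mp_dgla | move=> x; exact: maurer_cartanP]. Qed.
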